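(* Let $\varphi\colon\Omega\to\Omega$ be a homeomorphism of a locally compact space $\Omega$ and let $\Gamma$ and $\Lambda$ be Banach modules over $\mathrm{C}_0(\Omega)$. For $\mathcal{T}\in\mathscr{L}(\Gamma,\Lambda)$ the following assertions are equivalent. (a) $\mathcal{T}$ is a $T_\varphi$-homomorphism, i.e. $\mathcal{T}(fs)=T_\varphi f\cdot\mathcal{T}s$ for all $f\in\mathrm{C}_0(\Omega)$ and $s\in\Gamma$. (b) $T_\varphi I_s\subset I_{\mathcal{T}s}$ for every $s\in\Gamma$. (c) $\mathrm{supp}(\mathcal{T}s)\subset\varphi(\mathrm{supp}(s))$ for each $s\in\Gamma$.
   Context: All vector spaces are over a fixed field $\mathbb{K}\in\{\mathbb{R},\mathbb{C}\}$; locally compact spaces are Hausdorff; $\mathscr{L}(\Gamma,\Lambda)$ is the space of bounded linear maps; $\mathrm{C}_0(\Omega)$ is the Banach algebra of continuous $\mathbb{K}$-valued functions on $\Omega$ vanishing at infinity. A Banach module over $\mathrm{C}_0(\Omega)$ is a Banach space $\Gamma$ which is a $\mathrm{C}_0(\Omega)$-module with $\|fs\|\le\|f\|\|s\|$; it is always assumed non-degenerate, i.e. $\Gamma=\overline{\mathrm{lin}}\{fs:f\in\mathrm{C}_0(\Omega),s\in\Gamma\}$. The Koopman operator is $T_\varphi f=f\circ\varphi^{-1}$, $f\in\mathrm{C}_0(\Omega)$. For an element $s$ of a Banach module over $\mathrm{C}_0(\Omega)$, the supporting ideal is $I_s=\{f\in\mathrm{C}_0(\Omega):fs=0\}$ and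 the support is $\mathrm{supp}(s)=\{x\in\Omega:\text{each }f\in\mathrm{C}_0(\Omega)\text{ with }f(x)\ne0\text{ satisfies }fs\neq0\}$. *)

(* Defs.v *)
From HB Require Import structures.
From mathcomp Require Import all_boot all_order all_algebra.
From mathcomp Require Import complex.
From mathcomp Require Import all_classical all_reals all_analysis.

Set Implicit Arguments.
Unset Strict Implicit.
Unset Printing Implicit Defensive.

Import Order.TTheory GRing.Theory Num.Theory.
Import numFieldNormedType.Exports.

Local Open Scope classical_set_scope.
Local Open Scope ring_scope.

Reserved Notation "f ** s" (at level 40, left associativity).

(* The scalars are the real field R or its complexification R[i], both seen as
   numFieldTypes: norms then take their values in K itself, which over R[i]
   carries the partial order x <= y iff y - x is a nonnegative real. *)
Variant real_or_complex (R : realType) : numFieldType -> Prop :=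
| RealScalars : real_or_complex R R
| ComplexScalars : real_or_complex R R[i].

Record homeomorphism (X Y : topologicalType) := Homeomorphism {
  homeo_fun :> X -> Y;
  homeo_inv : Y -> X;
  homeo_funK : cancel homeo_fun homeo_inv;
  homeo_invK : cancel homeo_inv homeo_fun;
  homeo_continuous : continuous homeo_fun;
  homeo_inv_continuous : continuous homeo_inv }.

Definition vanishing_at_infinity (K : numFieldType) (X : topologicalType)
    (f : X -> K) :=
  forall e : K, 0 < e ->
    exists2 C : set X, compact C & forall x, ~ C x -> `|f x| < e.

Definition c0_pred (K : numFieldType) (X : topologicalType) :
    {pred X -> K^o} :=
  fun f => `[< continuous f /\ vanishing_at_infinity f >].

Record C0 (K : numFieldType) (X : topologicalType) := MkC0 {
  c0_fun :> X -> K^o;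
  _ : c0_fun \in @c0_pred K X }.

Section C0_theory.
Context {K : numFieldType} {X : topologicalType}.
Implicit Types f g : X -> K^o.

HB.instance Definition _ := [isSub for @c0_fun K X].
HB.instance Definition _ := [Choice of C0 K X by <:].

Lemma c0P f :
  reflect (continuous f /\ vanishing_at_infinity f) (f \in @c0_pred K X).
Proof. exact: asboolP. Qed.

Lemma c0_submod_closed : submod_closed (@c0_pred K X).
Proof.
split.
  apply/c0P; split; first by move=> x; exact: cvg_cst.
  by move=> e e0; exists set0; [exact: compact0|move=> x _; rewrite normr0].
move=> a f g /c0P[cf vf] /c0P[cg vg]; apply/c0P; split.
  move=> x; apply: (@cvgD K K^o); last exact: cg.
  by apply: (@cvgZr K K^o); exact: cf.
move=> e e0.
have a1 : 0 < `|a| + 1 by rewrite ltr_wpDl.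
have [|C cC fC] := vf (e / 2 / (`|a| + 1)); first by rewrite !divr_gt0.
have [|D cD gD] := vg (e / 2); first by rewrite divr_gt0.
exists (C `|` D); first exact: compactU.
move=> x /not_orP[/fC fx /gD gx].
rewrite (le_lt_trans (ler_normD _ _))// [ltRHS]splitr ler_ltD//.
rewrite normrZ (@le_trans _ _ ((`|a| + 1) * `|f x|))//.
  by rewrite ler_wpM2r// lerDl.
by rewrite mulrC -ler_pdivlMr// ltW.
Qed.

HB.instance Definition _ :=
  GRing.isSubmodClosed.Build K (X -> K^o) (@c0_pred K X) c0_submod_closed.
HB.instance Definition _ := [SubChoice_isSubLmodule of C0 K X by <:].

Lemma c0_mul_subproof (f g : C0 K X) :
  (fun x => f x * g x : K^o) \in @c0_pred K X.
Proof.
case: f g => f /= /c0P[cf vf] [g /= /c0P[cg vg]]; apply/c0P; split.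
  by move=> x; apply: cvgM; [exact: cf|exact: cg].
move=> e e0.
have [|C cC fC] := vf 1; first exact: ltr01.
have [D cD gD] := vg e e0.
exists (C `|` D); first exact: compactU.
move=> x /not_orP[/fC fx /gD gx]; rewrite normrM.
by rewrite (le_lt_trans _ gx)// ler_piMl// ltW.
Qed.

Definition c0_mul (f g : C0 K X) : C0 K X := MkC0 (c0_mul_subproof f g).

(* A K-valued supremum norm: for scalars R or R[i] the least upper bound exists
   in K as soon as X is inhabited, and the default value 0 is the norm of the
   only function when X is empty. *)
Definition c0_norm (f : C0 K X) : K := supremum 0 (range (fun x => `|f x|)).

Lemma koopman_subproof (phi : homeomorphism X X) (f : C0 K X) :
  (f \o homeo_inv phi) \in @c0_pred K X.
Proof.
case: f => f /= /c0P[cf vf]; apply/c0P; split.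
  move=> x; apply: continuous_comp; last exact: cf.
  exact: homeo_inv_continuous.
move=> e /vf[C cC fC]; exists (phi @` C).
  apply: continuous_compact => //; apply: continuous_subspaceT.
  exact: homeo_continuous.
move=> x nCx; apply: fC => Cx; apply: nCx.
by exists (homeo_inv phi x) => //; rewrite homeo_invK.
Qed.

Definition koopman (phi : homeomorphism X X) (f : C0 K X) : C0 K X :=
  MkC0 (koopman_subproof phi f).

End C0_theory.

Definition linear_span (K : numFieldType) (V : lmodType K) (S : set V) :
    set V :=
  [set v | exists n (a : 'I_n -> K) (s : 'I_n -> V),
     (forall i, S (s i)) /\ v = \sum_i a i *: s i].

HB.mixin Record isC0Module (K : numFieldType) (X : topologicalType) V
    of CompleteNormedModule K V := {
  c0_act : C0 K X -> V -> V;
  c0_actDl : forall f g s, c0_act (f + g) s = c0_act f s + c0_act g s;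
  c0_actDr : forall f s t, c0_act f (s + t) = c0_act f s + c0_act f t;
  c0_actZl : forall a f s, c0_act (a *: f) s = a *: c0_act f s;
  c0_actZr : forall a f s, c0_act f (a *: s) = a *: c0_act f s;
  c0_actM : forall f g s, c0_act (c0_mul f g) s = c0_act f (c0_act g s);
  c0_act_norm : forall f s, `|c0_act f s| <= c0_norm f * `|s|;
  c0_act_nondegenerate :
    closure (linear_span [set c0_act f s | f in setT & s in setT]) = setT }.

#[short(type="banachModType")]
HB.structure Definition BanachModule (K : numFieldType) (X : topologicalType) :=
  { V of isC0Module K X V & CompleteNormedModule K V }.

Notation "f ** s" := (c0_act f s) : ring_scope.

Section support.
Context {K : numFieldType} {X : topologicalType} {G : banachModType K X}.

Definition supporting_ideal (s : G) : set (C0 K X) := [set f | f ** s = 0].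

Definition supp (s : G) : set X :=
  [set x | forall f : C0 K X, f x != 0 -> f ** s != 0].

End support.

(* Main.v *)
Require Import Defs.
From HB Require Import structures.
From mathcomp Require Import all_boot all_order all_algebra.
From mathcomp Require Import complex.
From mathcomp Require Import ring lra.
From mathcomp Require Import all_classical all_reals all_analysis.

Set Implicit Arguments.
Unset Strict Implicit.
Unset Printing Implicit Defensive.

Import Order.TTheory GRing.Theory Num.Theory.
Import numFieldNormedType.Exports.

Local Open Scope classical_set_scope.
Local Open Scope ring_scope.

(** The implications from the intertwining relation to the inclusion of
    supporting ideals, and from there to the inclusion of supports, are direct
    computations. The substance is that an operator [T] with
    [supp (T s) `<=` phi @` supp s] intertwines.

    Two facts about Banach modules are used throughout: an element is the limit
    of [u ** z] for suitable [u] with values in the unit disc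
    ([approximate_unit]), and an element that is annihilated near each point
    vanishes ([locally_annihilated_eq0]). Thus identities in the target module
    can be checked pointwise on the space, and support inclusion is used only
    in the following form, called [local] below: if some [f] with [f x != 0]
    kills [s], then some [k] with [k x != 0] has [koopman phi k ** T s = 0].

    By linearity, [f] may be taken real-valued. One has to show that the defect
    [koopman phi (f u) ** T (w ** s) - koopman phi u ** T (f w ** s)] is zero.
    Suppose that the cut-off [w] lives where [f] is within 3/10 of an even
    integer. Write [f] as a continuous staircase, locally constant near the
    support of [w], plus a ripple of size at most 1/2. A locally constant
    factor can be moved across a local operator ([stair_commute]), so only the
    ripple contributes to the defect, and the defect is at most [M * `|s|] for
    a bound [M] of [T] ([hump_defect_le]). Four translates of the cut-off,
    suitably normalised, form a partition of unity, hence the defect of every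
    real [f], for [u] and [w] bounded by 1, is at most [80 * (M * `|s|)],
    whatever the size of [f]. The defect
    is linear in [f]; applied to all multiples of [f], the bound forces it to
    be zero ([real_defect_eq0]). Approximate units then remove [u] and [w].

    Grouping the values of [f] periodically is what makes the estimate work:
    the pieces of one group have disjoint supports, so that they can be summed
    under a single supremum norm, while the norms of the individual pieces of
    [s] need not be summable in a general Banach module. *)

(** * Real scalars *)

(** The common features of the reals and the complex numbers over the reals:
    [emb] embeds the real line, [re] takes real parts, [emb (re z) *+ 2 - z] is
    the conjugate of [z], and [imu] is the imaginary unit, or zero when there
    are only real scalars. *)
Record real_part (R : realType) (K : numFieldType) := RealPart {
  emb : {rmorphism R -> K};
  re : {additive K -> R};
  imu : K;
  emb_norm : forall t, `|emb t| = emb `|t|;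
  re_le : forall z, emb `|re z| <= `|z|;
  re_ge0 : forall z, 0 <= z -> emb (re z) = z;
  re_conj : forall z, (emb (re z) *+ 2 - z) * z = `|z| ^+ 2;
  re_im : forall z, emb (re z) + imu * emb (re (- imu * z)) = z }.

Lemma real_part_exists (R : realType) (K : numFieldType) :
  real_or_complex R K -> inhabited (real_part R K).
Proof.
case; constructor.
  apply: (@RealPart R R idfun idfun 0) => //= z.
    by rewrite mulr2n addrK -expr2 real_normK// num_real.
  by rewrite mul0r addr0.
apply: (@RealPart R R[i] (real_complex R) (@complex.Re R) 'i%C).
- by move=> t; rewrite normc_def/= expr0n/= addr0 sqrtr_sqr.
- exact: normc_ge_Re.
- by move=> z z0; rewrite /= RRe_real// ger0_real.
- by move=> z; rewrite -mulr_natl -addcJ addrC addKr mulrC sqr_normc.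
- by move=> z; rewrite [RHS]complexE mulNr raddfN/= [_ * z]mulrC ReiNIm opprK.
Qed.

Section scalars.
Context {R : realType} {K : numFieldType} (P : real_part R K).

Lemma emb_ge0 t : 0 <= t -> 0 <= emb P t.
Proof. by move=> t0; rewrite -(ger0_norm t0) -emb_norm. Qed.

Lemma emb_le s t : s <= t -> emb P s <= emb P t.
Proof. by move=> st; rewrite -subr_ge0 -rmorphB emb_ge0// subr_ge0. Qed.

Lemma emb_gt0 t : 0 < t -> 0 < emb P t.
Proof. by move=> t0; rewrite lt_def emb_ge0 ?ltW// fmorph_eq0 gt_eqF. Qed.

Lemma emb_lt s t : (emb P s < emb P t) = (s < t).
Proof.
apply/idP/idP => [|st]; last by rewrite -subr_gt0 -rmorphB emb_gt0// subr_gt0.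
by apply: contraTT; rewrite -leNgt => /emb_le ts; rewrite le_gtF.
Qed.

Lemma embK t : re P (emb P t) = t.
Proof.
have pos s : 0 <= s -> re P (emb P s) = s.
  by move=> s0; apply: (fmorph_inj (emb P)); rewrite re_ge0// emb_ge0.
have [/pos//|/ltW t0] := leP 0 t.
by apply: oppr_inj; rewrite -!raddfN pos// oppr_ge0.
Qed.

Lemma re_gt0 z : 0 < z -> 0 < re P z.
Proof. by move=> z0; rewrite -emb_lt rmorph0 re_ge0// ltW. Qed.

Lemma emb_continuous : continuous (emb P : R -> K^o).
Proof.
move=> t; apply/cvgrPdist_lt => e e0; near=> s.
rewrite -rmorphB emb_norm -(re_ge0 P (ltW e0)) emb_lt; near: s.
exact: cvgr_dist_lt (re_gt0 e0).
Unshelve. all: by end_near. Qed.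

Lemma emb_comp_continuous (X : topologicalType) (h : X -> R) :
  continuous h -> continuous (fun x => emb P (h x) : K^o).
Proof.
move=> hc x; apply: (@continuous_comp X R K^o h (emb P)); first exact: hc.
exact: emb_continuous.
Qed.

Lemma re_continuous : continuous (re P : K^o -> R).
Proof.
move=> z; apply/(@cvgrPdist_lt _ R^o _ (nbhs (z : K^o))) => e e0; near=> w.
rewrite -raddfB -emb_lt (le_lt_trans (re_le P _))//; near: w.
exact: (@cvgr_dist_lt _ K^o K^o (nbhs (z : K^o)) _ id z cvg_id _ (emb_gt0 e0)).
Unshelve. all: by end_near. Qed.

(** Being nonnegative, [z] and [c] are images of reals, so that the archimedean
    property of the reals applies. *)
Lemma archimedean_eq0 (z c : K) :
  0 <= z -> 0 <= c -> (forall n, z *+ n <= c) -> z = 0.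
Proof.
move=> z0 c0 zc; apply/eqP/negPn/negP => zN0.
have zp : 0 < re P z by rewrite re_gt0// lt_def zN0.
have [n cn] : exists n, re P c < re P z *+ n.
  exists (Num.bound `|re P c / re P z|).
  rewrite -mulr_natl -ltr_pdivrMr//; apply: le_lt_trans (ler_norm _) _.
  exact: archi_boundP.
have := zc n; rewrite -(re_ge0 P z0) -(re_ge0 P c0) -rmorphMn.
by rewrite lt_geF// emb_lt.
Qed.

End scalars.

(** * Functions vanishing at infinity *)

Section c0_functions.
Context {K : numFieldType} {X : topologicalType}.
Implicit Types (f g u : C0 K X).

(* Values are read in [K] rather than in the regular module [K^o], so that the
   field and order structures of [K] apply to them. *)
Local Notation ev f x := (c0_fun f x : K) (only parsing).

Lemma c0_ext f g : (forall x, ev f x = ev g x) -> f = g.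
Proof. by move=> fg; apply/val_inj/funext. Qed.

Lemma c0_continuous f : continuous f.
Proof. by have /c0P[] := valP f. Qed.

Lemma c0_vanishing f : vanishing_at_infinity f.
Proof. by have /c0P[] := valP f. Qed.

Lemma c0_bounded_mul (h : X -> K) (M : K) u :
  continuous (h : X -> K^o) -> (forall x, `|h x| <= M) ->
  exists w : C0 K X, forall x, ev w x = h x * ev u x.
Proof.
move=> hc hM; suff w0 : (fun x => h x * ev u x : K^o) \in @c0_pred K X.
  by exists (MkC0 w0).
apply/c0P; split; first by move=> x; apply: cvgM; [exact: hc|exact: c0_continuous].
move=> e e0.
have M1 : 0 < `|M| + 1 by rewrite ltr_wpDl.
have [|C cC uC] := @c0_vanishing u (e / (`|M| + 1)); first by rewrite divr_gt0.
exists C => // x /uC; rewrite ltr_pdivlMr// mulrC normrM; apply: le_lt_trans.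
rewrite ler_wpM2r// (le_trans (hM x))//.
have M0 : 0 <= M := le_trans (normr_ge0 _) (hM x).
by rewrite ger0_norm// lerDl.
Qed.

(** In the absence of a least upper bound, [c0_norm f] is the default value 0,
    which is below [M] as well. *)
Lemma c0_norm_le f (M : K) : 0 <= M -> (forall x, `|ev f x| <= M) -> c0_norm f <= M.
Proof.
move=> M0 fM; rewrite /c0_norm /supremum; case: ifPn => // _.
case: xgetP => [_ -> [_ lb]|//]; apply: lb.
by move=> _ [x _ <-]; exact: fM.
Qed.

Lemma c0_norm_ge0 f : 0 <= c0_norm f.
Proof.
rewrite /c0_norm /supremum; case: ifPn => // /set0P[_ [x _ _]].
case: xgetP => [_ -> [ub _]|//].
by apply: le_trans (ub _ (imageT _ x)).
Qed.

Lemma c0_sumE (I : Type) (r : seq I) (F : I -> C0 K X) x :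
  ev (\sum_(i <- r) F i) x = \sum_(i <- r) ev (F i) x.
Proof. by elim: r => [|i r IHr]; rewrite ?big_nil ?big_cons//= -IHr. Qed.

Lemma re_c0_continuous (R : realType) (P : real_part R K) f :
  continuous (fun x => re P (f x)).
Proof.
move=> x; apply: (@continuous_comp X K^o R f (re P)); last exact: re_continuous.
exact: c0_continuous.
Qed.

Lemma c0_real_part (R : realType) (P : real_part R K) f :
  exists f' : C0 K X, forall x, ev f' x = emb P (re P (f x)).
Proof.
suff f0 : (fun x => emb P (re P (f x)) : K^o) \in @c0_pred K X.
  by exists (MkC0 f0).
apply/c0P; split=> [x|e /(@c0_vanishing f)[C cC fC]].
  by apply: emb_comp_continuous; exact: re_c0_continuous.
by exists C => // x /fC; apply: le_lt_trans; rewrite emb_norm re_le.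
Qed.

(** The function is the complex conjugate of [f]. It serves to turn any [f]
    killing an element into the nonnegative function [`|f| ^+ 2], which is a
    multiple of [f] and hence kills it as well. *)
Lemma c0_conj (R : realType) (P : real_part R K) f :
  exists f' : C0 K X, forall x, ev f' x * ev f x = `|ev f x| ^+ 2.
Proof.
have [f' f'E] := c0_real_part P f.
by exists (f' *+ 2 - f) => x; rewrite -(re_conj P) -f'E.
Qed.

End c0_functions.

(** * Banach modules *)

Section banach_module.
Context {R : realType} {K : numFieldType} (P : real_part R K).
Context {X : topologicalType} {G : banachModType K X}.
Implicit Types (f u w : C0 K X) (s t z : G).

Local Notation ev f x := (c0_fun f x : K) (only parsing).

Lemma c0_act0l s : (0 : C0 K X) ** s = 0.
Proof. by rewrite -(scale0r (0 : C0 K X)) c0_actZl scale0r. Qed.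

Lemma c0_act0r f : f ** (0 : G) = 0.
Proof. by rewrite -(scale0r (0 : G)) c0_actZr !scale0r. Qed.

Lemma c0_actBl f u s : (f - u) ** s = f ** s - u ** s.
Proof. by rewrite c0_actDl -scaleN1r c0_actZl scaleN1r. Qed.

Lemma c0_actBr f s t : f ** (s - t) = f ** s - f ** t.
Proof. by rewrite c0_actDr -scaleN1r c0_actZr scaleN1r. Qed.

Lemma c0_act_sumr f (n : nat) (F : 'I_n -> G) :
  f ** (\sum_i F i) = \sum_i f ** F i.
Proof.
exact: (big_morph (c0_act f) (c0_actDr f) (c0_act0r f)).
Qed.

Lemma c0_act_le f s (M : K) :
  0 <= M -> (forall x, `|ev f x| <= M) -> `|f ** s| <= M * `|s|.
Proof.
move=> M0 fM; apply: le_trans (c0_act_norm f s) _.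
by rewrite ler_wpM2r// c0_norm_le.
Qed.

Lemma c0_actC f u s : f ** (u ** s) = u ** (f ** s).
Proof. by rewrite -!c0_actM; congr (_ ** _); apply: c0_ext => x; exact: mulrC. Qed.

Lemma norm_le_eps_eq0 z (c : K) :
  0 <= c -> (forall e : K, 0 < e -> `|z| <= c * e) -> z = 0.
Proof.
move=> c0 h; apply/eqP; rewrite -normr_eq0; apply/eqP.
apply: (archimedean_eq0 P (c := c)) => // n.
have [->|n0] := eqVneq n 0%N; first by rewrite mulr0n.
have n0' : 0 < n%:R :> K by rewrite ltr0n lt0n.
have := h n%:R^-1; rewrite invr_gt0 => /(_ n0').
by rewrite ler_pdivlMr// mulr_natr.
Qed.

Lemma continuous_inv1D (E : C0 K X) : (forall x, 0 <= ev E x) ->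
  continuous (fun x => (ev E x + 1)^-1 : K^o).
Proof.
move=> E0 x; apply: (@cvgV K); first by rewrite gt_eqF// ltr_wpDl.
by apply: (@cvgD K K^o); [exact: c0_continuous|exact: cvg_cst].
Qed.

Lemma inv1D_le1 (E : C0 K X) x : 0 <= ev E x -> `|(ev E x + 1)^-1| <= 1.
Proof.
move=> E0; have E1 : 0 < E x + 1 by rewrite ltr_wpDl.
by rewrite normfV gtr0_norm// invf_le1// lerDr.
Qed.

(** Approximate [z] by a combination of elements [f i ** t i]. Then
    [u := E / (E + 1)] with [E] the sum of the [`|f i| ^+ 2 / d ^+ 2] works:
    each [f i - u * f i] equals [f i / (E + 1)], and it has norm at most [d]
    because [y <= y ^+ 2 + 1] for [y := `|f i| / d]. *)
Lemma approximate_unit z (e : K) : 0 < e ->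
  exists2 u : C0 K X, (forall x, `|ev u x| <= 1) & `|z - u ** z| < e.
Proof.
move=> e0; have e3 : 0 < e / 3 by rewrite divr_gt0.
have : closure (linear_span [set c0_act f s | f in setT & s in setT]) z.
  by rewrite c0_act_nondegenerate.
move=> /(_ _ (@cvgr_dist_lt K G G (nbhs z) _ id z cvg_id _ e3)).
move=> [w [[n [a [s [fs wE]]]] /= zw]].
have {fs} /choice[ft ftE] i : exists ft : C0 K X * G, ft.1 ** ft.2 = s i.
  by have [f _ [t _ <-]] := fs i; exists (f, t).
pose C : K := \sum_i `|a i| * `|(ft i).2|.
have Cge0 : 0 <= C by apply: sumr_ge0 => i _; rewrite mulr_ge0.
have C1 : 0 < C + 1 by rewrite ltr_wpDl.
pose d := e / 3 / (C + 1); have d0 : 0 < d by rewrite divr_gt0.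
have /choice[g gE] i := c0_conj P (ft i).1.
pose E : C0 K X := \sum_i d ^- 2 *: c0_mul (g i) (ft i).1.
have EE x : ev E x = \sum_i (`|ev (ft i).1 x| / d) ^+ 2.
  rewrite c0_sumE; apply: eq_bigr => i _.
  have -> : ev (d ^- 2 *: c0_mul (g i) (ft i).1) x =
    d ^- 2 * (ev (g i) x * ev (ft i).1 x) by [].
  by rewrite gE [RHS]exprMn exprVn [LHS]mulrC.
have E0 x : 0 <= ev E x by rewrite EE sumr_ge0// => i _; rewrite exprn_ge0// divr_ge0// ltW.
have [u uE] := c0_bounded_mul E (continuous_inv1D E0) (fun x => inv1D_le1 (E0 x)).
have E1 x : 0 < ev E x + 1 by rewrite ltr_wpDl.
have u1 x : `|ev u x| <= 1.
  by rewrite uE ger0_norm ?mulr_ge0 ?invr_ge0 ?(ltW (E1 x))// ler_pdivrMl// mulr1 lerDl.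
exists u => //.
have uw : `|w - u ** w| <= d * C.
  rewrite wE c0_act_sumr -sumrB mulr_sumr; apply: le_trans (ler_norm_sum _ _ _) _.
  apply: ler_sum => i _; rewrite c0_actZr -scalerBr normrZ mulrCA ler_wpM2l//.
  rewrite -ftE -c0_actM -c0_actBl; apply: c0_act_le; first exact: ltW.
  move=> x; set y := ev (ft i).1 x.
  have -> : ev ((ft i).1 - c0_mul u (ft i).1) x = y / (ev E x + 1).
    have -> : ev ((ft i).1 - c0_mul u (ft i).1) x = y - ev u x * y by [].
    rewrite uE; field.
    by rewrite gt_eqF.
  rewrite normrM normfV (gtr0_norm (E1 x)) ler_pdivrMr// mulrC -ler_pdivrMr//.
  have y0 : 0 <= `|y| / d by rewrite divr_ge0// ltW.
  apply: (@le_trans _ _ ((`|y| / d) ^+ 2 + 1)); last first.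
    rewrite lerD2r EE (bigD1 i)//= lerDl sumr_ge0// => j _.
    by rewrite exprn_ge0// divr_ge0// ltW.
  have /orP[y1|y1] := real_leVge (ger0_real y0) (real1 K).
    by rewrite (le_trans y1)// lerDr exprn_ge0.
  by rewrite (le_trans (_ : _ <= (`|y| / d) ^+ 2))// ?lerDl// expr2 ler_peMr.
have dC : d * C < e / 3.
  by rewrite /d mulrAC ltr_pdivrMr// ltr_pM2l// ltrDl.
have -> : z - u ** z = (z - w) + (w - u ** w) + u ** (w - z).
  by rewrite c0_actBr -addrA !subrKA.
have -> : e = e / 3 + e / 3 + e / 3 by field.
apply: le_lt_trans (ler_normD _ _) _; apply: ltr_leD.
  by apply: le_lt_trans (ler_normD _ _) _; rewrite ltrD// (le_lt_trans uw).
rewrite (le_trans (c0_act_le _ ler01 u1))// mul1r distrC; exact: ltW.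
Qed.

(** The annihilator of [z] is an ideal, and it contains nonnegative functions
    [F] as large as desired on a given compact set. Indeed it contains the
    square modulus of a function not vanishing at a given point, and sums of
    such functions are handled by compactness. Now [u] is [v * F + v] with
    [v := u / (F + 1)], so that [u ** z = v ** z], and [v] is small where [F] is
    large. Only points with [u x != 0] have to be covered, so that the
    assumption on [z] can be applied to [g := u]. *)
Lemma locally_annihilated_eq0 z :
  (forall x (g : C0 K X), ev g x != 0 -> exists2 f : C0 K X, ev f x != 0 & f ** z = 0) ->
  z = 0.
Proof.
move=> zloc.
have small u (e : K) : (forall x, `|ev u x| <= 1) -> 0 < e ->
    `|u ** z| <= e * `|z|.
  move=> u1 e0.
  pose J (F : C0 K X) := (forall x, 0 <= ev F x) /\ F ** z = 0.
  (* The annihilator is directed upwards; its tails form the filter to which the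
     near-covering form of compactness is applied. *)
  pose above (F : C0 K X) := [set F' | J F' /\ forall x, ev F x <= ev F' x].
  suff [F [F0 Fz] FC] : exists2 F, J F & forall x, `|ev u x| <= e * (ev F x + 1).
    have [v vE] := c0_bounded_mul u (continuous_inv1D F0) (fun x => inv1D_le1 (F0 x)).
    have F1 x : 0 < ev F x + 1 by rewrite ltr_wpDl.
    have -> : u = c0_mul v F + v.
      apply: c0_ext => x.
      have -> : ev (c0_mul v F + v) x = ev v x * ev F x + ev v x by [].
      by rewrite vE; field; rewrite gt_eqF.
    rewrite c0_actDl c0_actM Fz c0_act0r add0r; apply: c0_act_le; first exact: ltW.
    by move=> x; rewrite vE normrM normfV (gtr0_norm (F1 x)) ler_pdivrMl// mulrC.
  have [C cC uC] := @c0_vanishing _ _ u e e0.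
  have J0 : J 0 by split=> //; exact: c0_act0l.
  have JD F F' : J F -> J F' -> J (F + F').
    move=> [F0 Fz] [F'0 F'z]; split; last by rewrite c0_actDl Fz F'z addr0.
    by move=> x; exact: (addr_ge0 (F0 x) (F'0 x)).
  have FF : Filter (filter_from J above).
    apply: filter_from_filter; first by exists 0.
    move=> F F' JF JF'; exists (F + F'); first exact: JD.
    move=> H [JH FH]; split; split=> // x; apply: le_trans (FH x).
      by rewrite [leRHS]/(ev F x + ev F' x) lerDl JF'.1.
    by rewrite [leRHS]/(ev F x + ev F' x) lerDr JF.1.
  have := (compact_near_coveringP _).1 cC _ _
    (fun F x => `|ev u x| <= e * (ev F x + 1)) FF.
  case=> [x Cx|F JF FC]; last first.
    exists F => // x; have [Cx|/uC ux] := pselect (C x); first exact: (FC F).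
    by rewrite (le_trans (ltW ux))// ler_peMr ?(ltW e0)// lerDr JF.1.
  have [ux|ux] := boolP (`|ev u x| < e).
    have unear : \forall x' \near x, `|ev u x'| < e.
      have e'0 : 0 < e - `|ev u x| by rewrite subr_gt0.
      near=> x'; rewrite -[ev u x'](subKr (ev u x)).
      apply: le_lt_trans (ler_normB _ _) _; rewrite addrC -ltrBrDr.
      near: x'; exact: cvgr_dist_lt (@c0_continuous _ _ u x) _ e'0.
    exists ([set x' | `|ev u x'| < e], J); first split=> //=.
      by exists 0 => // F [].
    move=> [x' F] [/= ux' JF].
    by rewrite (le_trans (ltW ux'))// ler_peMr ?(ltW e0)// lerDr JF.1.
  have /zloc[f fx fz] : ev u x != 0.
    by apply: contraNneq ux => ->; rewrite normr0.
  have [g gE] := c0_conj P f.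
  (* The factor makes F equal to 2 / e at x, hence larger than 1 / e near x. *)
  pose c := 2 * e^-1 / `|ev f x| ^+ 2.
  have c0 : 0 <= c by rewrite divr_ge0 ?mulr_ge0 ?invr_ge0 ?(ltW e0).
  pose F := c *: c0_mul g f.
  have FE y : ev F y = c * `|ev f y| ^+ 2 by rewrite -gE.
  have JF : J F.
    split=> [y|]; first by rewrite FE mulr_ge0.
    by rewrite c0_actZl c0_actM fz c0_act0r scaler0.
  have Fx : \forall x' \near x, e^-1 < ev F x'.
    have FxE : ev F x = 2 * e^-1 by rewrite FE divfK// expf_neq0 ?normr_eq0.
    have e'0 : 0 < e^-1 by rewrite invr_gt0.
    near=> x'; rewrite -(ltrD2l e^-1) -mulr2n -mulr_natl -FxE -ltrBlDr.
    apply: le_lt_trans (_ : `|ev F x - ev F x'| < _).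
      by rewrite real_ler_norm// rpredB// ger0_real// JF.1.
    near: x'; exact: cvgr_dist_lt (@c0_continuous _ _ F x) _ e'0.
  exists ([set x' | e^-1 < ev F x'], above F); first by split=> //; exists F.
  move=> [x' F'] [/= Fx' [JF' FF']].
  rewrite (le_trans (u1 x'))// -ler_pdivrMl// mulr1 (le_trans (ltW Fx'))//.
  by rewrite (le_trans (FF' x'))// lerDl.
apply: (@norm_le_eps_eq0 _ (1 + `|z|)) => [|e e0]; first exact: addr_ge0.
have [u u1 zu] := approximate_unit z e0.
rewrite -[leLHS](congr1 _ (subrK (u ** z) z)) mulrDl mul1r [`|z| * e]mulrC.
by rewrite (le_trans (ler_normD _ _))// lerD ?small// ltW.
Unshelve. all: by end_near. Qed.

End banach_module.

(** * A staircase on the real line *)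

Section triangle_wave.
Context {R : realType}.
Implicit Types (s t : R) (k : int).

(** The distance from [t] to the set of even integers: the integer in the
    formula is half of the even integer nearest to [t]. *)
Definition wave t : R := `|t - 2 * (Num.floor ((t + 1) / 2))%:~R|.

Lemma wave_attained t : exists k, wave t = `|t - 2 * k%:~R|.
Proof. by exists (Num.floor ((t + 1) / 2)). Qed.

Lemma wave_le1 t : wave t <= 1.
Proof.
have /andP[] := floor_itv ((t + 1) / 2); rewrite intrD => a b.
by rewrite /wave ler_norml; apply/andP; split; lra.
Qed.

Lemma wave_near t k : `|t - 2 * k%:~R| <= 1 -> wave t = `|t - 2 * k%:~R|.
Proof.
have /andP[] := floor_itv ((t + 1) / 2); rewrite intrD /wave.
set m := Num.floor _ => a b /[dup] tk; rewrite ler_norml => /andP[c d].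
have [mk|mk|->//] := ltgtP m k.
  have : m%:~R + 1 <= k%:~R :> R by rewrite -intrD1 ler_int lezD1.
  lra.
have {}mk : k%:~R + 1 <= m%:~R :> R by rewrite -intrD1 ler_int lezD1.
by rewrite ler0_norm ?ger0_norm; lra.
Qed.

Lemma wave_le t k : wave t <= `|t - 2 * k%:~R|.
Proof.
have [/wave_near ->//|/ltW] := leP `|t - 2 * k%:~R| 1.
exact: le_trans (wave_le1 t).
Qed.

Lemma wave_ge0 t : 0 <= wave t. Proof. exact: normr_ge0. Qed.

Lemma wave_lipschitz s t : `|wave s - wave t| <= `|s - t|.
Proof.
have H s' t' : wave s' <= wave t' + `|s' - t'|.
  have [k ->] := wave_attained t'.
  by rewrite (le_trans (wave_le s' k))// [leRHS]addrC ler_distD.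
have := H s t; have := H t s; rewrite (distrC t s) => a b.
by rewrite ler_norml; apply/andP; split; lra.
Qed.

Lemma wave_continuous : continuous wave.
Proof.
move=> t; apply/cvgrPdist_lt => e e0; near=> s.
apply: le_lt_trans (wave_lipschitz _ _) _; near: s.
exact: cvgr_dist_lt cvg_id _ e0.
Unshelve. all: by end_near. Qed.

(** A cut-off around the even integers. Its radius 3/10 is less than 1/2, the
    radius on which [fun t => t - ripple t] is constant, and more than 1/4,
    so that the translates by multiples of 1/2 cover the line. *)
Definition hump t : R := Num.max 0 (3 / 10 - wave t).

Definition humps t : R := hump t + hump (t - 1 / 2) + hump (t - 1) + hump (t - 3 / 2).

(** This function agrees with [t - 2 * k] where [t] is within 1/2 of the even
    integer [2 * k], so that [t - ripple t] is a continuous staircase. *)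
Definition ripple t : R := wave (t + 1 / 2) - 1 / 2.

Lemma hump_ge0 t : 0 <= hump t.
Proof. by rewrite le_max lexx. Qed.

Lemma hump_le1 t : hump t <= 1.
Proof. by rewrite ge_max ler01/=; have := wave_ge0 t; lra. Qed.

Lemma hump_lower t k : `|t - 2 * k%:~R| <= 1 / 4 -> 1 / 20 <= hump t.
Proof. by move=> tk; rewrite le_max; have := wave_le t k; lra. Qed.

Lemma humps_ge t : 1 / 20 <= humps t.
Proof.
have /andP[] := floor_itv ((t + 1 / 4) / 2); rewrite intrD.
set m := Num.floor _ => a b; rewrite /humps.
have := hump_ge0 t; have := hump_ge0 (t - 1 / 2).
have := hump_ge0 (t - 1); have := hump_ge0 (t - 3 / 2) => h3 h2 h1 h0.
have [u0|u0] := leP t (2 * m%:~R + 1 / 4).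
  suff : 1 / 20 <= hump t by lra.
  by apply: (@hump_lower _ m); rewrite ler_norml; apply/andP; split; lra.
have [u1|u1] := leP t (2 * m%:~R + 3 / 4).
  suff : 1 / 20 <= hump (t - 1 / 2) by lra.
  by apply: (@hump_lower _ m); rewrite ler_norml; apply/andP; split; lra.
have [u2|u2] := leP t (2 * m%:~R + 5 / 4).
  suff : 1 / 20 <= hump (t - 1) by lra.
  by apply: (@hump_lower _ m); rewrite ler_norml; apply/andP; split; lra.
suff : 1 / 20 <= hump (t - 3 / 2) by lra.
by apply: (@hump_lower _ m); rewrite ler_norml; apply/andP; split; lra.
Qed.

Lemma hump_continuous : continuous hump.
Proof.
move=> t; apply: (@continuous_max _ R (fun=> 0) (fun s => 3 / 10 - wave s)).
  exact: cvg_cst.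
by apply: cvgB; [exact: cvg_cst|exact: wave_continuous].
Qed.

Lemma shift_continuous (f : R -> R) a : continuous f ->
  continuous (fun t => f (t + a)).
Proof.
move=> fc t; apply: (@continuous_comp _ _ _ (fun t => t + a) f); last exact: fc.
by apply: cvgD; [exact: cvg_id|exact: cvg_cst].
Qed.

Lemma humps_continuous : continuous humps.
Proof.
have hc a : continuous (fun t => hump (t - a)).
  exact: shift_continuous hump_continuous.
move=> t; apply: (@cvgD R R); last exact: hc.
apply: (@cvgD R R); last exact: hc.
by apply: (@cvgD R R); [exact: hump_continuous|exact: hc].
Qed.

Lemma ripple_continuous : continuous ripple.
Proof.
move=> t; apply: cvgB; last exact: cvg_cst.
exact: (shift_continuous wave_continuous).
Qed.

Lemma ripple_norm t : `|ripple t| <= 1 / 2.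
Proof.
have := wave_ge0 (t + 1 / 2); have := wave_le1 (t + 1 / 2) => a b.
by rewrite ler_norml /ripple; apply/andP; split; lra.
Qed.

(** The radii 3/10 and 1/2 of [hump] and of the steps of the staircase leave a
    margin of 1/5, which gives the uniform choice of [d] in the second case. *)
Lemma stair_or_flat t : exists2 d : R, 0 < d &
  (exists c, forall s, `|s - t| < d -> s - ripple s = c) \/
  (forall s, `|s - t| < d -> hump s = 0).
Proof.
have [k wk] := wave_attained t.
have [w|w] := ltP (wave t) (1 / 2).
  exists (1 / 2 - wave t); first by lra.
  left; exists (2 * k%:~R) => s; rewrite wk ltrBrDr => sk.
  have {sk} : `|s - 2 * k%:~R| < 1 / 2.
    by apply: le_lt_trans sk; rewrite ler_distD.
  rewrite ltr_norml => /andP[a b].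
  rewrite /ripple (@wave_near _ k); last by rewrite ler_norml; apply/andP; split; lra.
  by rewrite ger0_norm; lra.
exists (1 / 5); first by lra.
right=> s st; rewrite /hump; apply/max_idPl.
have := wave_lipschitz s t; rewrite ler_norml => /andP[a b]; lra.
Qed.

End triangle_wave.

(** * Local operators intertwine *)

Section intertwining.
Context {R : realType} {K : numFieldType} (P : real_part R K).
Context {X : topologicalType} (phi : homeomorphism X X).
Context {G L : banachModType K X} (T : {linear G -> L}).
Implicit Types (f u v w k : C0 K X) (s : G) (z : L).

Local Notation ev f x := (c0_fun f x : K) (only parsing).
Local Notation koop := (koopman phi).

Definition homeomorphism_inverse : homeomorphism X X :=
  Homeomorphism (homeo_invK phi) (homeo_funK phi)
    (@homeo_inv_continuous _ _ phi) (@homeo_continuous _ _ phi).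

Lemma koopmanD f u : koop (f + u) = koop f + koop u.
Proof. exact: c0_ext. Qed.

Lemma koopmanZ a f : koop (a *: f) = a *: koop f.
Proof. exact: c0_ext. Qed.

Lemma koopmanM f u : koop (c0_mul f u) = c0_mul (koop f) (koop u).
Proof. exact: c0_ext. Qed.

(** The composition with [phi] only moves the points, and [x] corresponds to
    [phi x]. *)
Lemma koopman_act_eq0 z :
  (forall x k, ev k x != 0 -> exists2 f, ev f x != 0 & koop f ** z = 0) -> z = 0.
Proof.
move=> zloc; apply: (locally_annihilated_eq0 P) => y g gy.
have [|f fx fz] := zloc (homeo_inv phi y) (koopman homeomorphism_inverse g).
  by rewrite /= homeo_invK.
by exists (koop f).
Qed.

(** Inclusion of supports, [supp (T s) `<=` phi @` supp s], in contraposed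
    form. *)
Definition local := forall s x f, ev f x != 0 -> f ** s = 0 ->
  exists2 k, ev k x != 0 & koop k ** T s = 0.

Context (T_local : local).

(** The difference of both sides is annihilated near each point [x]. Either the
    staircase is a constant [c] near [x], which can be moved across [T], while
    [qw - c w] vanishes near [x]; or [w] and [qw] vanish near [x]. In both
    cases, locality transports the vanishing to the images under [T]. *)
Lemma stair_commute (g : X -> R) s u v qu qw w :
  continuous g ->
  (forall x, ev w x = emb P (hump (g x)) * ev v x) ->
  (forall x, ev qu x = emb P (g x - ripple (g x)) * ev u x) ->
  (forall x, ev qw x = emb P (g x - ripple (g x)) * ev w x) ->
  koop qu ** T (w ** s) = koop u ** T (qw ** s).
Proof.
move=> gc wE quE qwE; apply/subr0_eq/koopman_act_eq0 => x k kx.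
have [d d0 qd] := stair_or_flat (g x).
(* The bump k' lives where g is within d of g x. *)
have bc : continuous (fun y => emb P (Num.max 0 (d - `|g y - g x|)) : K^o).
  apply: emb_comp_continuous => y.
  apply: (@continuous_max _ X (fun=> 0) (fun y => d - `|g y - g x|)).
    exact: cvg_cst.
  apply: (@cvgB R R); first exact: cvg_cst.
  apply: (@cvg_norm R R); apply: (@cvgB R R); [exact: gc|exact: cvg_cst].
have [|k' k'E] := @c0_bounded_mul K X _ (emb P d) k bc.
  move=> y; rewrite emb_norm emb_le// ger0_norm ?le_max ?lexx//.
  by rewrite ge_max ltW//= lerBlDr lerDl.
have k'x : ev k' x != 0.
  rewrite k'E subrr normr0 subr0 mulf_neq0//.
  by rewrite fmorph_eq0 (max_r (ltW d0)) gt_eqF.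
have k'0 y : d <= `|g y - g x| -> ev k' y = 0.
  by move=> dy; rewrite k'E max_l ?subr_le0// rmorph0 mul0r.
have kill f : (forall y, `|g y - g x| < d -> ev f y = 0) -> k' ** (f ** s) = 0.
  move=> f0; rewrite -c0_actM -[RHS](c0_act0l s); congr (_ ** _).
  apply: c0_ext => y; suff: ev k' y * ev f y = 0 by [].
  by have [/f0 ->|/k'0 ->] := ltP `|g y - g x| d; rewrite ?mulr0 ?mul0r.
case: qd => [[c qc]|h0].
  pose W := qw - emb P c *: w.
  have /(T_local k'x)[f fx fW] : k' ** (W ** s) = 0.
    apply: kill => y /qc gy; suff: ev qw y - emb P c * ev w y = 0 by [].
    by rewrite qwE gy subrr.
  exists (c0_mul f k'); first exact: mulf_neq0.
  have TW : T (qw ** s) = T (W ** s) + emb P c *: T (w ** s).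
    by rewrite -linearZ -linearD c0_actBl c0_actZl subrK.
  have qu' : koop k' ** (koop qu ** T (w ** s)) =
      emb P c *: (koop k' ** (koop u ** T (w ** s))).
    rewrite -!c0_actM -c0_actZl -!koopmanM -koopmanZ; congr (koop _ ** _).
    apply: c0_ext => y.
    suff: ev k' y * ev qu y = emb P c * (ev k' y * ev u y) by [].
    have [/qc gy|/k'0 ->] := ltP `|g y - g x| d; last by rewrite !mul0r mulr0.
    by rewrite quE gy mulrCA.
  rewrite koopmanM c0_actM.
  have -> : koop k' ** (koop qu ** T (w ** s) - koop u ** T (qw ** s)) =
      (- 1) *: (koop k' ** (koop u ** T (W ** s))).
    by rewrite c0_actBr qu' TW !c0_actDr !c0_actZr opprD addrCA subrr addr0 scaleN1r.
  rewrite c0_actZr (c0_actC (koop f)) (c0_actC (koop f)) fW.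
  by rewrite !c0_act0r scaler0.
have w0 y : `|g y - g x| < d -> ev w y = 0.
  by move=> /h0 gy; rewrite wE gy rmorph0 mul0r.
have qw0 y : `|g y - g x| < d -> ev qw y = 0 by move=> /w0 wy; rewrite qwE wy mulr0.
have [f fx fw] := T_local k'x (kill _ w0).
have [f' f'x f'w] := T_local k'x (kill _ qw0).
exists (c0_mul f f'); first exact: mulf_neq0.
rewrite koopmanM c0_actM !c0_actBr.
rewrite (c0_actC _ (koop u)) f'w (c0_actC (koop f') (koop qu)).
by rewrite (c0_actC (koop f) (koop qu)) (c0_actC (koop f)) fw !c0_act0r subrr.
Qed.

(** How far [T] is from intertwining, tested against [u] on the left and [w] on
    the right. The test function [u] makes it possible to multiply by functions
    of [f] that do not vanish at infinity. *)
Definition defect f u w s : L :=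
  koop (c0_mul f u) ** T (w ** s) - koop u ** T (c0_mul f w ** s).

Lemma c0_mulDr f u v : c0_mul f (u + v) = c0_mul f u + c0_mul f v.
Proof. by apply: c0_ext => x; exact: mulrDr. Qed.

Lemma c0_mulZr a f u : c0_mul f (a *: u) = a *: c0_mul f u.
Proof. by apply: c0_ext => x; exact: mulrCA. Qed.

Lemma c0_mulZl a f u : c0_mul (a *: f) u = a *: c0_mul f u.
Proof. by apply: c0_ext => x; exact/esym/mulrA. Qed.

Lemma defectD f u v w s : defect f u (v + w) s = defect f u v s + defect f u w s.
Proof.
by rewrite /defect c0_mulDr !c0_actDl !linearD !c0_actDr opprD addrACA.
Qed.

Lemma defectZ a f u w s : defect f u (a *: w) s = a *: defect f u w s.
Proof. by rewrite /defect c0_mulZr !c0_actZl !linearZ !c0_actZr scalerBr. Qed.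

Lemma defectZl a f u w s : defect (a *: f) u w s = a *: defect f u w s.
Proof.
rewrite /defect !c0_mulZl koopmanZ !c0_actZl linearZ c0_actZr scalerBr//.
Qed.

Context (M : K) (M_ge0 : 0 <= M) (T_le : forall s, `|T s| <= M * `|s|).

Lemma koopman_act_le f z (c : K) :
  0 <= c -> (forall x, `|ev f x| <= c) -> `|koop f ** z| <= c * `|z|.
Proof. by move=> c0 fc; apply: c0_act_le => // x; exact: fc. Qed.

(** Up to the constant [a] and a staircase, both of which can be moved across
    [T], the function [f] is a ripple of size at most 1/2. The bound does not
    depend on the size of [f]. *)
Lemma hump_defect_le (g : X -> R) (a : R) f u v w s :
  continuous g ->
  (forall x, ev f x = emb P (g x)) ->
  (forall x, ev w x = emb P (hump (g x - a)) * ev v x) ->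
  (forall x, `|ev u x| <= 1) -> (forall x, `|ev v x| <= 1) ->
  `|defect f u w s| <= M * `|s|.
Proof.
move=> gc fE wE u1 v1.
have w1 x : `|ev w x| <= 1.
  rewrite wE normrM emb_norm (ger0_norm (hump_ge0 _)) mulr_ile1//.
    exact/emb_ge0/hump_ge0.
  by rewrite -(rmorph1 (emb P)) emb_le ?hump_le1.
pose g' x := g x - a.
have g'c : continuous g'.
  by move=> x; apply: (@cvgB R R); [exact: gc|exact: cvg_cst].
have rc : continuous (fun x => emb P (ripple (g' x)) : K^o).
  apply: emb_comp_continuous => x.
  apply: (@continuous_comp X R R g' ripple); last exact: ripple_continuous.
  exact: g'c.
have half : emb P (1 / 2) = 2^-1 by rewrite div1r fmorphV rmorph_nat.
have r1 x : `|emb P (ripple (g' x))| <= 2^-1.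
  by rewrite -half emb_norm emb_le// ripple_norm.
have [ru ruE] := c0_bounded_mul u rc r1.
have [rw rwE] := c0_bounded_mul w rc r1.
have h0 : 0 <= 2^-1 :> K by rewrite invr_ge0.
have ru1 x : `|ev ru x| <= 2^-1 by rewrite ruE normrM -[leRHS]mulr1 ler_pM// r1.
have rw1 x : `|ev rw x| <= 2^-1 by rewrite rwE normrM -[leRHS]mulr1 ler_pM// r1.
pose qu := c0_mul f u - emb P a *: u - ru.
pose qw := c0_mul f w - emb P a *: w - rw.
have quw : koop qu ** T (w ** s) = koop u ** T (qw ** s).
  apply: (@stair_commute g' s u v) => // x.
    suff : ev f x * ev u x - emb P a * ev u x - ev ru x =
        emb P (g' x - ripple (g' x)) * ev u x by [].
    by rewrite fE ruE !rmorphB !mulrBl.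
  suff : ev f x * ev w x - emb P a * ev w x - ev rw x =
      emb P (g' x - ripple (g' x)) * ev w x by [].
  by rewrite fE rwE !rmorphB !mulrBl.
have -> : defect f u w s = koop ru ** T (w ** s) - koop u ** T (rw ** s).
  have fu : c0_mul f u = qu + emb P a *: u + ru by rewrite addrAC !subrK.
  have fw : c0_mul f w = qw + emb P a *: w + rw by rewrite addrAC !subrK.
  clearbody qu qw; rewrite /defect fu fw !koopmanD koopmanZ !c0_actDl !c0_actZl.
  rewrite !(linearD T) (linearZ_LR T) !c0_actDr c0_actZr quw.
  by rewrite opprD addrACA subrr add0r.
have -> : M * `|s| = 2^-1 * (M * `|s|) + M * (2^-1 * `|s|) by field.
have Ts f1 (c : K) : 0 <= c -> (forall x, `|ev f1 x| <= c) ->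
    `|T (f1 ** s)| <= M * (c * `|s|).
  by move=> c0 fc; rewrite (le_trans (T_le _))// ler_wpM2l// c0_act_le.
rewrite (le_trans (ler_normB _ _))// lerD//.
  rewrite (le_trans (koopman_act_le _ h0 ru1))// ler_wpM2l//.
  by rewrite (le_trans (Ts _ _ ler01 w1))// mul1r.
by rewrite (le_trans (koopman_act_le _ ler01 u1))// mul1r Ts.
Qed.

(** The bound of [hump_defect_le] holds for all multiples of [f], so that the
    archimedean property applies. *)
Lemma real_defect_eq0 f u v s :
  (forall x, ev f x = emb P (re P (ev f x))) ->
  (forall x, `|ev u x| <= 1) -> (forall x, `|ev v x| <= 1) ->
  defect f u v s = 0.
Proof.
move=> fre u1 v1.
apply/eqP; rewrite -normr_eq0; apply/eqP.
apply: (archimedean_eq0 P (c := 80 * (M * `|s|))) => [//||n].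
  by rewrite mulr_ge0// mulr_ge0.
pose g x := n%:R * re P (ev f x).
have gc : continuous g.
  move=> x; apply: (@cvgM R); first exact: cvg_cst.
  exact: re_c0_continuous.
(* The sum of the humps is at least 1/20, so that dividing v by 20 times this sum
   keeps it bounded by 1. *)
have Sc : continuous (fun x => emb P (20 * humps (g x))^-1 : K^o).
  apply: emb_comp_continuous => x.
  apply: (@cvgV R); first by have := humps_ge (g x) => ?; apply: lt0r_neq0; lra.
  apply: (@cvgM R); first exact: cvg_cst.
  apply: (@continuous_comp X R R g humps); last exact: humps_continuous.
  exact: gc.
have S0 x : 0 < humps (g x) by have := humps_ge (g x); lra.
have S1 x : `|emb P (20 * humps (g x))^-1| <= 1.
  rewrite emb_norm -(rmorph1 (emb P)) emb_le// ger0_norm.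
    by rewrite invf_le1 ?mulr_gt0//; have := humps_ge (g x); lra.
  by rewrite invr_ge0 mulr_ge0// ltW.
have [v' v'E] := c0_bounded_mul v Sc S1.
have v'1 x : `|ev v' x| <= 1 by rewrite v'E normrM mulr_ile1.
have hump_mul a : exists w, forall x, ev w x = emb P (hump (g x - a)) * ev v' x.
  apply: (@c0_bounded_mul K X _ 1 v') => x.
    apply: emb_comp_continuous => {}x.
    apply: (@continuous_comp X R R (fun x => g x - a) hump); last first.
      exact: hump_continuous.
    by apply: (@cvgB R R); [exact: gc|exact: cvg_cst].
  rewrite emb_norm ger0_norm ?hump_ge0// -(rmorph1 (emb P)) emb_le//.
  exact: hump_le1.
have [w0 w0E] := hump_mul 0.
have [w1 w1E] := hump_mul (1 / 2).
have [w2 w2E] := hump_mul 1.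
have [w3 w3E] := hump_mul (3 / 2).
have vE : v = 20%:R *: (w0 + w1 + w2 + w3).
  apply: c0_ext => x.
  suff : ev v x = 20%:R * (ev w0 x + ev w1 x + ev w2 x + ev w3 x) by [].
  rewrite w0E w1E w2E w3E -!mulrDl -!rmorphD subr0 -/(humps (g x)) v'E.
  rewrite mulrA -(rmorph_nat (emb P)) mulrA -!rmorphM/=.
  by rewrite divff ?rmorph1 ?mul1r// mulf_neq0// gt_eqF.
have nfE x : ev (n%:R *: f) x = emb P (g x).
  by rewrite rmorphM rmorph_nat -fre.
have b a w : (forall x, ev w x = emb P (hump (g x - a)) * ev v' x) ->
    `|defect (n%:R *: f) u w s| <= M * `|s|.
  by move=> wE; apply: (hump_defect_le _ gc nfE wE u1 v'1).
have <- : `|n%:R *: defect f u v s| = `|defect f u v s| *+ n.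
  by rewrite normrZ ger0_norm// mulr_natl.
rewrite -defectZl vE defectZ normrZ.
rewrite !defectD ger0_norm//.
have -> : 80 * (M * `|s|) =
    20 * (M * `|s| + M * `|s| + M * `|s| + M * `|s|) :> K by ring.
rewrite ler_wpM2l//.
do 3! (rewrite (le_trans (ler_normD _ _))// lerD//; last exact: b).
exact: b w0E.
Qed.

(** Approximate units replace [s] by [v ** s] and reduce the equality to one
    tested against [u]; there it is the vanishing of the defect. *)
Lemma real_intertwines f s : (forall x, ev f x = emb P (re P (ev f x))) ->
  T (f ** s) = koop f ** T s.
Proof.
move=> fre; apply/subr0_eq.
have act0 u : (forall x, `|ev u x| <= 1) ->
    koop u ** (T (f ** s) - koop f ** T s) = 0.
  move=> u1; pose c := M * c0_norm f + c0_norm (koop (c0_mul f u)) * M.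
  have c0 : 0 <= c by rewrite addr_ge0// mulr_ge0// c0_norm_ge0.
  apply: (norm_le_eps_eq0 P c0) => e e0.
  have [v v1 sv] := approximate_unit P s e0.
  have /eqP := real_defect_eq0 s fre u1 v1; rewrite subr_eq0 => /eqP vE.
  have -> : koop u ** (T (f ** s) - koop f ** T s) =
      koop u ** T (f ** (s - v ** s)) - koop (c0_mul f u) ** T (s - v ** s).
    rewrite [in RHS]c0_actBr !(linearB T) !c0_actBr -[f ** (v ** s)]c0_actM -vE.
    rewrite opprB addrA subrK -c0_actM.
    by congr (_ - _ ** _); apply: c0_ext => x; exact: mulrC.
  rewrite (le_trans (ler_normB _ _))// mulrDl lerD//.
    rewrite (le_trans (koopman_act_le _ ler01 u1))// mul1r.
    rewrite (le_trans (T_le _))// -mulrA ler_wpM2l//.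
    by rewrite (le_trans (c0_act_norm _ _))// ler_wpM2l ?c0_norm_ge0// ltW.
  rewrite (le_trans (c0_act_norm _ _))// -mulrA ler_wpM2l ?c0_norm_ge0//.
  by rewrite (le_trans (T_le _))// ler_wpM2l// ltW.
apply: (norm_le_eps_eq0 P ler01) => e e0.
set z := T _ - _; have [u u1 zu] := approximate_unit P z e0.
have := act0 (koopman homeomorphism_inverse u) (fun x => u1 _).
have -> : koop (koopman homeomorphism_inverse u) = u.
  by apply: c0_ext => x; rewrite /= homeo_invK.
by rewrite mul1r -/z => uz; move: zu; rewrite uz subr0 => /ltW.
Qed.

Lemma local_intertwines f s : T (f ** s) = koop f ** T s.
Proof.
have [a aE] := c0_real_part P f.
have [b bE] := c0_real_part P (- imu P *: f).
have -> : f = a + imu P *: b.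
  apply: c0_ext => x; suff : ev f x = ev a x + imu P * ev b x by [].
  by rewrite aE bE -[LHS](re_im P).
rewrite koopmanD koopmanZ !c0_actDl !c0_actZl linearD linearZ_LR.
by rewrite !real_intertwines// => x; rewrite ?aE ?bE embK.
Qed.

End intertwining.

(** * The equivalence *)

Theorem theorem3p10 (R : realType) (K : numFieldType)
    (hK : real_or_complex R K)
    (Omega : topologicalType) (hausdorff_Omega : hausdorff_space Omega)
    (locally_compact_Omega : locally_compact [set: Omega])
    (phi : homeomorphism Omega Omega)
    (Gamma Lambda : banachModType K Omega)
    (T : {linear Gamma -> Lambda})
    (bounded_T : bounded_near T (nbhs (0 : Gamma))) :
  [<-> forall (f : C0 K Omega) (s : Gamma), T (f ** s) = koopman phi f ** T s;
       forall s : Gamma,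
         koopman phi @` supporting_ideal s `<=` supporting_ideal (T s);
       forall s : Gamma, supp (T s) `<=` phi @` supp s].
Proof.
have [P] := real_part_exists hK.
tfae.
- by move=> TE s _ [f fs <-]; rewrite /supporting_ideal/= -TE fs linear0.
- move=> ideal s y Ty; exists (homeo_inv phi y); last exact: homeo_invK.
  move=> f fx; apply/eqP => fs.
  by have /eqP := Ty (koopman phi f) fx; apply; apply: ideal; exists f.
move=> supp_sub f s.
have T_local : local phi T.
  move=> {}s x {}f fx fs; apply: contrapT => nk.
  suff /supp_sub[x' sx' /(can_inj (homeo_funK phi)) x'x] : supp (T s) (phi x).
    by have := sx' f; rewrite x'x => /(_ fx); rewrite fs eqxx.
  move=> k kx; apply/eqP => kT; apply: nk.
  exists (koopman (homeomorphism_inverse phi) k) => //.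
  by rewrite -[RHS]kT; congr (_ ** _); apply: c0_ext => y; rewrite /= homeo_invK.
have [M [Mreal TM]] := (linear_boundedP T).1 bounded_T.
have MM : M < `|M| + 1 by rewrite ltr_pwDr// real_ler_norm.
apply: (local_intertwines P T_local (M := `|M| + 1)); first by rewrite addr_ge0.
exact: TM MM.
Qed.
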